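(* Let $\rho<0$ and $\gamma<0$. Let $X$ and $Y$ be nonpositive random variables whose supports have upper endpoint $0$, and set $\widetilde X=-1/X$, $\widetilde Y=-1/Y$. Let $\widetilde\alpha\in RV_{-\rho}$ and $\widetilde a\in RV_{-\gamma}$ be positive functions and suppose there is a non-null Radon measure $\mu$ on $[0,\infty]\times(0,\infty]$ with $$t\,\mathbb P\left[\left(\frac{\widetilde X}{\widetilde\alpha(t)},\frac{\widetilde Y}{\widetilde a(t)}\right)\in\cdot\right]\xrightarrow{\ \mathrm v\ }\mu(\cdot)\quad\text{in } M_+([0,\infty]\times(0,\infty]),$$ and such that for each $y>0$, $x\mapsto\mu([0,x]\times(y,\infty])$ is a nondegenerate distribution function. Suppose also that for every $z>0$, $$\lim_{\epsilon\downarrow0}\limsup_{t\to\infty}t\,\mathbb P\left[\frac{\widetilde X}{\widetilde\alpha(t)}>\frac{z}{\epsilon}\right]=0.$$ Then $(XY)^{-1}$ has a regularly varying tail of index $-1/(|\gamma|+|\rho|)$, and as $t\to\infty$, $t\,\mathbb P\left[(XY)^{-1}/(\widetilde\alpha(t)\widetilde a(t))\in\cdot\right]$ converges vaguely to some nondegenerate Radon measure on $(0,\infty]$.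
   Context: $RV_c$ denotes the class of positive measurable functions $f$ with $f(tx)/f(x)\to t^c$ as $x\to\infty$ for all $t>0$; a random variable $W$ has a regularly varying tail of index $-c$ if $\mathbb P[W>\cdot]\in RV_{-c}$. Vague convergence in $M_+(\mathsf S)$ means convergence on relatively compact continuity sets of the limit. *)

(* Defs.v *)
From HB Require Import structures.
From mathcomp Require Import all_boot all_order all_algebra.
From mathcomp Require Import all_classical all_reals all_analysis measurable_realfun.
Set Implicit Arguments. Unset Strict Implicit. Unset Printing Implicit Defensive.
Import Order.TTheory GRing.Theory Num.Theory.
Import numFieldNormedType.Exports.
Local Open Scope classical_set_scope.
Local Open Scope ring_scope.
Local Open Scope ereal_scope.

Definition regvar (R : realType) (c : R) (f : R -> R) : Prop :=
  measurable_fun setT f /\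
  (forall x : R, (0 < x)%R -> (0 < f x)%R) /\
  (forall t : R, (0 < t)%R ->
     (f (t * x) / f x)%R @[x --> +oo%R] --> (t `^ c)%R).

(* relative compactness / relative boundary inside a subspace E of a
   compact Hausdorff ambient space (here \bar R or \bar R * \bar R) *)
Definition rel_compact (T : topologicalType) (E A : set T) : Prop :=
  compact (closure A) /\ closure A `<=` E.

Definition rel_interior (T : topologicalType) (E A : set T) : set T :=
  [set x | A x /\ exists U : set T, [/\ open U, U x & U `&` E `<=` A]].

Definition rel_boundary (T : topologicalType) (E A : set T) : set T :=
  (closure A `&` E) `\` rel_interior E A.

Definition radon_on (R : realType) (T : topologicalType)
  (meas : set T -> Prop) (E : set T) (mu : set T -> \bar R) : Prop :=
  mu (~` E) = 0 /\
  forall A, meas A -> rel_compact E A -> mu A < +oo.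

Definition vague_cvg (R : realType) (T : topologicalType)
  (meas : set T -> Prop) (E : set T)
  (nu : R -> set T -> \bar R) (mu : set T -> \bar R) : Prop :=
  forall A, meas A -> rel_compact E A -> mu (rel_boundary E A) = 0 ->
    nu t A @[t --> +oo%R] --> mu A.

Definition tilde (R : realType) (x : R) : \bar R :=
  if (x < 0)%R then (- x^-1)%:E else +oo.

Definition inv_prod (R : realType) (x y : R) : \bar R :=
  if (x * y != 0)%R then ((x * y)^-1)%:E else +oo.

Definition degenerate_df (R : realType) (F : R -> \bar R) : Prop :=
  exists (c : R) (M : \bar R), forall x : R, (0 <= x)%R ->
    F x = if (c <= x)%R then M else 0.

Definition quadrant (R : realType) : set (\bar R * \bar R) :=
  [set p | 0 <= p.1 /\ 0 < p.2].

Definition posline (R : realType) : set (\bar R) := [set x | 0 < x].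
Arguments quadrant R : clear implicits.
Arguments posline R : clear implicits.

(* Main.v *)
Require Import Defs.
From HB Require Import structures.
From mathcomp Require Import all_boot all_order all_algebra.
From mathcomp Require Import all_classical all_reals all_analysis measurable_realfun.
From mathcomp Require Import ring lra.
Import Order.TTheory GRing.Theory Num.Theory.
Import numFieldNormedType.Exports.
Local Open Scope classical_set_scope.
Local Open Scope ring_scope.
Local Open Scope ereal_scope.

(* The limit measure is [nu A = mu {(x, y) | xy \in A, xy > 0}]. Truncating to
   [y > e] makes the preimage of a continuity set relatively compact in the
   quadrant, and the product is continuous there except at [(0, +oo)]; the part
   [y <= e] of [xy > z] forces [x > z / e] and is negligible by the last
   hypothesis. That [mu] charges neither a line [y = e] nor the line [y = +oo]
   comes from the scaling of the limits: comparing the levels [b t] and [b (s t)]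
   gives [H (s^k z) = H z / s] for the tail [H] of the limit along a normalization
   [b] of index [k], hence [H z = z^(-1/k) H 1]. The same scaling applied to [nu]
   gives its power tail, with [H 1 > 0] because otherwise [mu] would live on
   [x = 0], contradicting nondegeneracy. Finally the regular variation of the tail
   of the product is read off along the geometric grid [l^n], by sandwiching [x]
   between [b t] and [b (l t)] and letting [l] tend to 1; no uniform convergence
   theorem for regularly varying functions is needed. *)

Set Implicit Arguments.
Unset Strict Implicit.
Unset Printing Implicit Defensive.

(** * Topology and measurability of the extended reals *)

(** The distance on [\bar R] is read through [contract], so [expand] is an isometry from [[-1, 1]]
    onto it and transports compactness. *)
Lemma ereal_compact (R : realType) : compact [set: \bar R].
Proof.
have -> : [set: \bar R] = @expand R @` `[(-1)%R, 1%R].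
  apply/seteqP; split => // x _; exists (contract x); last exact: contractK.
  by rewrite /= in_itv/= -ler_norml contract_le1.
apply: continuous_compact; last exact: segment_compact.
apply/subspace_continuousP => x /= xI.
apply/cvg_ballP => e e0.
rewrite near_withinE; apply: filterS (nbhsx_ballx x e e0) => y xy yI.
change (`|contract (expand x) - contract (expand y)| < e)%R.
by rewrite !expandK// !inE ler_norml; [move: yI|move: xI]; rewrite /= in_itv.
Qed.

(** The finite part of [U] is the image of an open set of reals; what remains is at most the two
    infinite points. *)
Lemma open_emeasurable (R : realType) (U : set (\bar R)) :
  open U -> measurable U.
Proof.
move=> oU.
have -> : U = EFin @` (EFin @^-1` U) `|` (U `&` [set +oo]) `|` (U `&` [set -oo]).
  apply/seteqP; split => [[r| |] Ux|x]; rewrite /=.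
  - by left; left; exists r.
  - by left; right.
  - by right.
  - by move=> [[[r Ur <-]|[]]|[]].
have m1 (x : \bar R) : measurable (U `&` [set x]).
  have [Ux|nUx] := pselect (U x).
    by rewrite setIidr; [exact: emeasurable_set1|move=> _ ->].
  by rewrite (_ : _ `&` _ = set0)// -subset0 => y /= [Uy yx]; apply: nUx; rewrite -yx.
apply: measurableU => //; apply: measurableU => //.
apply: measurable_image_EFin; apply: open_measurable.
apply: open_comp => // x _; exact: cvg_comp.
Qed.

Lemma countable_bigcup_measurable d (T : measurableType d) (I : Type)
    (D : set I) (F : I -> set T) :
  countable D -> (forall i, D i -> measurable (F i)) ->
  measurable (\bigcup_(i in D) F i).
Proof.
elim/Ppointed: I => I in D F *; first by move=> *; rewrite emptyE bigcup_set0.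
move=> /countable_injP[f fi] mF.
have -> : \bigcup_(i in D) F i = \bigcup_n \bigcup_(i in [set i | D i /\ f i = n]) F i.
  apply/seteqP; split=> [x [i Di Fx]|x [n _ [i [Di _] Fx]]]; last by exists i.
  by exists (f i) => //; exists i.
apply: bigcupT_measurable => n.
have [[i [Di fin]]|noi] := pselect (exists i, D i /\ f i = n).
  rewrite (_ : [set _ | _] = [set i]) ?bigcup_set1; first exact: mF.
  apply/seteqP; split=> [j [Dj fj]|j ->]//=.
  by apply: fi; rewrite ?inE// fj.
rewrite (_ : [set _ | _] = set0) ?bigcup_set0//.
by rewrite -subset0 => i Hi; apply: noi; exists i.
Qed.

(** Compactness gives [\bar R] a countable base, so [W] is a countable union of open rectangles.
    This is what makes relative boundaries measurable for the product sigma-algebra. *)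
Lemma open_prod_emeasurable (R : realType) (W : set (\bar R * \bar R)) :
  open W -> measurable W.
Proof.
move=> oW.
have [B cB [oB bB]] := @compact_second_countable R _ (@ereal_compact R).
have -> : W = \bigcup_(UV in [set UV | (B `*` B) UV /\ UV.1 `*` UV.2 `<=` W])
                (UV.1 `*` UV.2).
  apply/seteqP; split=> [[x y] Wxy|xy [UV [_ /=]]]; last exact.
  have /= [[P Q] /= [/bB [U /= [BU Ux] UP] /bB [V /= [BV Vy] VQ]] PQW] :=
    open_nbhs_nbhs (conj oW Wxy).
  exists (U, V) => //=; split=> // -[a b]/= [/UP Pa /VQ Qb]; exact: PQW.
apply: countable_bigcup_measurable.
- apply: (@sub_countable _ _ _ (B `*` B)); last exact: countableX.
  by apply: subset_card_le => ? [].
- by move=> [U V] [[/= /oB oU /oB oV] _]; apply: measurableX; exact: open_emeasurable.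
Qed.

(** Distinct fibres of [f] are disjoint, so only finitely many can have mass at least [1/(n+1)]
    inside a set of finite mass. *)
Lemma countable_atoms (R : realType) d (T : measurableType d)
    (m : {measure set T -> \bar R}) (f : T -> \bar R) (D : set T) :
  measurable D -> m D < +oo -> measurable_fun setT f ->
  countable [set w : R | m (D `&` f @^-1` [set w%:E]) != 0].
Proof.
move=> mD Dfin mf.
have mDf w : measurable (D `&` f @^-1` [set w%:E]).
  apply: measurableI => //.
  by rewrite -[_ @^-1` _]setTI; apply: mf => //; exact: emeasurable_set1.
pose S n := [set w : R | (n.+1%:R^-1)%:E <= m (D `&` f @^-1` [set w%:E])].
have -> : [set w : R | m (D `&` f @^-1` [set w%:E]) != 0] = \bigcup_n S n.
  apply/seteqP; split => [w /= w0|w [n _ /= Sw]]; last first.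
    by rewrite gt_eqF// (lt_le_trans _ Sw)// lte_fin invr_gt0.
  have mgt0 : 0 < m (D `&` f @^-1` [set w%:E]) by rewrite lt0e w0 measure_ge0.
  have mfin : m (D `&` f @^-1` [set w%:E]) \is a fin_num.
    rewrite ge0_fin_numE// (le_lt_trans _ Dfin)// le_measure ?inE//.
  rewrite -(fineK mfin) lte_fin in mgt0.
  exists (Num.truncn (fine (m (D `&` f @^-1` [set w%:E])))^-1) => //=.
  rewrite /S /= -[leRHS]fineK// lee_fin invf_ple ?posrE//.
  by rewrite ltW// truncnS_gt.
apply: bigcup_countable => // n _; apply: finite_set_countable.
apply: contrapT => /infiniteP /ppcard_leP[g].
have gS k : S n (g k) by exact: funS.
have gI : injective g by move=> x y /inj; rewrite !inE; exact.
(* With more than [m D * (n+1)] fibres of mass at least [1/(n+1)], the total would exceed [m D]. *)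
pose N := (Num.truncn (fine (m D) * n.+1%:R)).+1.
have : \sum_(i < N) (n.+1%:R^-1)%:E <= m D.
  apply: (@le_trans _ _ (\sum_(i < N) m (D `&` f @^-1` [set (g i)%:E]))).
    by apply: lee_sum => i _; exact: gS.
  rewrite -(@measure_bigsetU _ _ _ m (fun i : nat => D `&` f @^-1` [set (g i)%:E]))//.
    apply: le_measure; rewrite ?inE//.
      exact: bigsetU_measurable.
    rewrite -(bigcup_mkord N (fun i : nat => D `&` f @^-1` [set (g i)%:E])).
    by apply: bigcup_sub => i _ x [].
  move=> i j _ _ [x [[_ /= fi] [_ /= fj]]].
  by apply: gI; move: fj; rewrite fi => -[].
rewrite sumEFin sumr_const card_ord -(@fineK _ (m D)) ?ge0_fin_numE//.
rewrite lee_fin -[leLHS]mulr_natr [leLHS]mulrC ler_pdivrMr ?ltr0n//.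
by rewrite leNgt truncnS_gt.
Qed.

(** If every level in the interval were charged, the interval would be countable and hence of
    Lebesgue measure zero. *)
Lemma null_level_between (R : realType) d (T : measurableType d)
    (m : {measure set T -> \bar R}) (f : T -> \bar R) (D : set T) (u v : R) :
  measurable D -> m D < +oo -> measurable_fun setT f -> (u < v)%R ->
  exists2 w : R, (u < w < v)%R & m (D `&` f @^-1` [set w%:E]) = 0.
Proof.
move=> mD Dfin mf uv; apply: contrapT => /forall2NP H.
have cI : countable `]u, v[%classic.
  have := countable_atoms mD Dfin mf; apply: sub_countable.
  apply: subset_card_le => w; rewrite /= in_itv/= => uwv.
  by apply/eqP; case: (H w).
have := countable_lebesgue_measure0 cI.
by rewrite lebesgue_measure_itv/= lte_fin uv => /eqP; rewrite gt_eqF// lte_fin subr_gt0.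
Qed.

(** * Tails with a regularly varying normalization *)

Section tail_inversion.
Context {R : realType}.
Variables (k : R) (b G : R -> R).
Hypothesis k0 : (0 < k)%R.
Hypothesis b0 : forall t : R, (0 < t)%R -> (0 < b t)%R.
Hypothesis bRV : forall s : R, (0 < s)%R ->
  (b (s * t) / b t)%R @[t --> +oo%R] --> (s `^ k)%R.
Hypothesis Gni : {homo G : x y /~ (x <= y)%R}.

Let scale_pinfty (s : R) : (0 < s)%R -> (s * t)%R @[t --> +oo%R] --> +oo%R.
Proof.
move=> s0; apply/cvgryPge => A; near=> t.
by rewrite mulrC -ler_pdivrMr//; near: t; exact: nbhs_pinfty_ge.
Unshelve. all: end_near. Qed.

(** * Scaling of the limiting tail *)

Section homogeneity.
Variables (H : R -> R) (C : set R).
Hypothesis Hni : forall x y : R, (0 < x)%R -> (x <= y)%R -> (H y <= H x)%R.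
Hypothesis Hright : forall z e : R, (0 < z)%R -> (0 < e)%R ->
  exists2 z', (z < z')%R & (H z <= H z' + e)%R.
Hypothesis Cdense : forall u v : R, (0 < u)%R -> (u < v)%R ->
  exists2 w, (u < w < v)%R & C w.
Hypothesis Hcvg : forall w : R, (0 < w)%R -> C w ->
  (t * G (w * b t))%R @[t --> +oo%R] --> H w.

Let Hcvg_scale (w s : R) : (0 < w)%R -> (0 < s)%R -> C w ->
  (s * t * G (w * b (s * t)))%R @[t --> +oo%R] --> H w.
Proof.
by move=> w0 s0 /(Hcvg w0); apply: cvg_comp (scale_pinfty s0).
Qed.

(* Levels [w], [v] in [C] strictly between the given ones absorb the error in
   [b (s t) / b t -> s^k]. *)
Let tail_scale_le (s z1 z2 : R) : (0 < s)%R -> (0 < z1)%R -> (z1 < z2)%R ->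
  (H z2 <= s * H (s `^ k * z1))%R.
Proof.
move=> s0 z10 z12; have sk0 : (0 < s `^ k)%R by exact: powR_gt0.
have [w /andP[z1w wz2] Cw] := Cdense z10 z12.
have w0 := lt_trans z10 z1w.
have [||v /andP[z1v vw] Cv] := @Cdense (s `^ k * z1)%R (s `^ k * w)%R.
- exact: mulr_gt0.
- by rewrite ltr_pM2l.
have skz10 : (0 < s `^ k * z1)%R by exact: mulr_gt0.
have v0 := lt_trans skz10 z1v.
apply: (le_trans (Hni w0 (ltW wz2))).
apply: (@le_trans _ _ (s * H v)%R); last by rewrite ler_pM2l// Hni// ltW.
apply: (ler_cvg_to (Hcvg_scale w0 s0 Cw) (cvgM (cvg_cst s) (Hcvg v0 Cv))).
near=> t; have t0 : (0 < t)%R by near: t; exact: nbhs_pinfty_gt.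
rewrite -mulrA ler_pM2l// ler_pM2l//; apply: Gni.
suff : (v / w <= b (s * t) / b t)%R.
  by rewrite ler_pdivrMr// mulrAC ler_pdivlMr ?b0// [(_ * w)%R]mulrC.
near: t; apply: (cvgr_ge _ (bRV s0)).
by rewrite ltr_pdivrMr.
Unshelve. all: end_near. Qed.

(** Mirror image of [tail_scale_le]: here [v] lies above [s^k w], so eventually
    [w b(s t) <= v b(t)]. *)
Let tail_scale_ge (s z1 z2 : R) : (0 < s)%R -> (0 < z1)%R -> (z1 < z2)%R ->
  (s * H (s `^ k * z2) <= H z1)%R.
Proof.
move=> s0 z10 z12; have sk0 : (0 < s `^ k)%R by exact: powR_gt0.
have [w /andP[z1w wz2] Cw] := Cdense z10 z12.
have w0 := lt_trans z10 z1w.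
have [||v /andP[wv vz2] Cv] := @Cdense (s `^ k * w)%R (s `^ k * z2)%R.
- exact: mulr_gt0.
- by rewrite ltr_pM2l.
have v0 : (0 < v)%R by apply: lt_trans wv; exact: mulr_gt0.
apply: (@le_trans _ _ (s * H v)%R); first by rewrite ler_pM2l// Hni// ltW.
apply: (@le_trans _ _ (H w)); last exact: (Hni z10 (ltW z1w)).
apply: (ler_cvg_to (cvgM (cvg_cst s) (Hcvg v0 Cv)) (Hcvg_scale w0 s0 Cw)).
near=> t; have t0 : (0 < t)%R by near: t; exact: nbhs_pinfty_gt.
rewrite -mulrA ler_pM2l// ler_pM2l//; apply: Gni.
suff : (b (s * t) / b t <= v / w)%R.
  by rewrite ler_pdivlMr// mulrAC ler_pdivrMr ?b0// [(_ * w)%R]mulrC.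
near: t; apply: (cvgr_le _ (bRV s0)).
by rewrite ltr_pdivlMr.
Unshelve. all: end_near. Qed.

(** The two one-sided bounds need a strict gap between levels; [Hright], a form of right continuity,
    closes it up to any [e]. *)
Let tail_scale (s z : R) : (0 < s)%R -> (0 < z)%R -> H z = (s * H (s `^ k * z))%R.
Proof.
move=> s0 z0; have sk0 : (0 < s `^ k)%R by exact: powR_gt0.
have skz0 : (0 < s `^ k * z)%R by exact: mulr_gt0.
apply/eqP; rewrite eq_le; apply/andP; split; apply/ler_addgt0Pr => e e0.
  have [z' zz' /le_trans->//] := Hright z0 e0.
  by rewrite lerD2r; exact: tail_scale_le.
have es0 : (0 < e / s)%R by exact: divr_gt0.
have [z' zz' Hz'] := Hright skz0 es0.
apply: (@le_trans _ _ (s * (H z' + e / s))%R); first by rewrite ler_pM2l.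
rewrite mulrDr mulrCA divff ?gt_eqF// mulr1 lerD2r.
have := @tail_scale_ge s z (z' / s `^ k)%R s0 z0.
rewrite mulrCA divff ?gt_eqF// mulr1; apply.
by rewrite ltr_pdivlMr// mulrC.
Qed.

(** The factor [s = z^(-1/k)] carries the level [z] to [1]. *)
Lemma tail_powR (z : R) : (0 < z)%R -> H z = (z `^ (- k^-1) * H 1)%R.
Proof.
move=> z0; rewrite {1}(@tail_scale (z `^ (- k^-1))%R)//; last exact: powR_gt0.
by rewrite -powRrM mulNr mulVf ?gt_eqF// powR_inv1 ?ltW// mulVf ?gt_eqF.
Qed.

End homogeneity.

(** Monotonicity of [b] is not assumed. Along the grid [l^n t0] the values of [b] grow at least
    geometrically, so they pass any [x]; the grid point just before the first passage is the
    required [t]. *)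
Lemma eventually_bracketed (l t1 : R) : (1 < l)%R ->
  \forall x \near +oo%R, exists2 t, (t1 <= t)%R & (b t <= x < b (l * t))%R.
Proof.
move=> l1; have l0 : (0 < l)%R by exact: lt_trans l1.
have lk1 : (1 < l `^ k)%R.
  by have := @gt0_ltr_powR R k k0 1%R l; rewrite powR1 !nnegrE; apply; rewrite ?ltW.
have [q [q1 qlk]] : exists q : R, (1 < q /\ q < l `^ k)%R.
  by exists ((1 + l `^ k) / 2)%R; split; lra.
have : \forall t \near +oo%R, (q <= b (l * t) / b t)%R.
  exact: (cvgr_ge _ (bRV l0)).
move=> [M [_ HM]].
(* [M + 1] because the eventual bound holds strictly beyond [M]; [1] ensures positivity. *)
pose t0 := (Num.max (Num.max t1 (M + 1)) 1)%R.
have t00 : (0 < t0)%R by rewrite /t0 !lt_max ltr01 orbT.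
have t1t0 : (t1 <= t0)%R by rewrite /t0 !le_max lexx.
have grow t : (t0 <= t)%R -> (q * b t <= b (l * t))%R.
  move=> t0t; rewrite -ler_pdivlMr; last by apply: b0; exact: lt_le_trans t0t.
  by apply: HM; apply: lt_le_trans t0t; rewrite /t0 !lt_max ltrDl ltr01 orbT.
have lt0 n : (t0 <= l ^+ n * t0)%R.
  by rewrite ler_peMl ?exprn_ege1 ?ltW.
have geo n : (q ^+ n * b t0 <= b (l ^+ n * t0))%R.
  elim: n => [|n IH]; first by rewrite !expr0 !mul1r.
  rewrite !exprS -!mulrA; apply: le_trans (grow _ (lt0 n)).
  by rewrite ler_pM2l//; exact: lt_trans q1.
have qn n : (n%:R * (q - 1) <= q ^+ n)%R.
  elim: n => [|n IH]; first by rewrite mul0r.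
  have qn1 : (1 <= q ^+ n)%R by rewrite exprn_ege1// ltW.
  rewrite -natr1 exprS; nra.
near=> x.
have x0 : (0 <= x)%R by near: x; exact: nbhs_pinfty_ge.
have bx : (b t0 <= x)%R by near: x; apply: nbhs_pinfty_ge; exact: num_real.
have ex : exists n, (x < b (l ^+ n * t0))%R.
  exists (Num.truncn (x / b t0 / (q - 1))).+1; apply: lt_le_trans (geo _).
  rewrite -ltr_pdivrMr ?b0//; apply: lt_le_trans (qn _).
  by rewrite -ltr_pdivrMr ?subr_gt0// truncnS_gt.
case: (ex_minnP ex) => -[|n] xn nmin.
  by move: xn; rewrite expr0 mul1r ltNge bx.
exists (l ^+ n * t0)%R; first exact: le_trans (lt0 n).
rewrite mulrA -exprS xn andbT leNgt; apply/negP => /nmin.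
by rewrite ltnn.
Unshelve. all: end_near. Qed.

(** For [b t <= x < b (l t)], monotonicity puts [G (s x) / G x] between [G (s b(l t)) / G (b t)] and
    [G (s b t) / G (b(l t))], whose limits are [s^p / l] and [l s^p]. *)
Lemma regvar_of_tail (c p : R) : (0 < c)%R ->
  (forall w : R, (0 < w)%R ->
    (t * G (w * b t))%R @[t --> +oo%R] --> (w `^ p * c)%R) ->
  (forall x : R, 0 < G x)%R /\
  (forall s : R, (0 < s)%R -> (G (s * x) / G x)%R @[x --> +oo%R] --> (s `^ p)%R).
Proof.
move=> c0 Gcvg.
have G1cvg : (t * G (b t))%R @[t --> +oo%R] --> c.
  have := Gcvg 1%R ltr01; rewrite powR1 mul1r.
  by under eq_fun do rewrite mul1r.
have Gl (w l : R) : (0 < w)%R -> (0 < l)%R ->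
    (t * G (w * b (l * t)))%R @[t --> +oo%R] --> (l^-1 * (w `^ p * c))%R.
  move=> w0 l0.
  have := cvg_comp _ _ (scale_pinfty l0) (Gcvg w w0).
  move=> /(cvgM (cvg_cst l^-1%R)); apply: cvg_trans.
  apply: near_eq_cvg; near=> t.
  by rewrite /= /cst !mulrA mulVf ?mul1r// gt_eqF.
have G1l (l : R) : (0 < l)%R -> (t * G (b (l * t)))%R @[t --> +oo%R] --> (l^-1 * c)%R.
  move=> l0; have := Gl 1%R l ltr01 l0; rewrite powR1 mul1r.
  by under eq_fun do rewrite mul1r.
(* [G] is positive at [b (2 t)] for all large [t], and any [x] lies below such a value. *)
have Gpos x : (0 < G x)%R.
  have : \forall t \near +oo%R, (0 < t * G (b (2 * t)))%R.
    by apply: (cvgr_gt _ (G1l 2%R _)) => //; rewrite mulr_gt0// invr_gt0.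
  move=> [M [_ HM]].
  have [M' [_ HM']] := eventually_bracketed (Num.max (M + 1) 1)%R (ltr1n R 2).
  have [|t Mt /andP[_ xt]] := HM' (Num.max x (M' + 1))%R.
    by rewrite lt_max ltrDl ltr01 orbT.
  move: Mt; rewrite ge_max => /andP[Mt t1].
  have t0 : (0 < t)%R by exact: lt_le_trans t1.
  have := HM t; rewrite pmulr_rgt0// => /(_ _)/lt_le_trans; apply.
    by apply: lt_le_trans Mt; rewrite ltrDl.
  by apply: Gni; move: xt; rewrite gt_max => /andP[/ltW].
split=> // s s0; set r := (s `^ p)%R.
have r0 : (0 < r)%R by exact: powR_gt0.
apply/cvgrPdist_le => e e0.
(* This choice gives [l r = r + e/2 < r + e] and also [r / l > r - e], leaving room for both
   limits. *)
pose l := (1 + e / (2 * r))%R.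
have l1 : (1 < l)%R by rewrite ltrDl divr_gt0// mulr_gt0.
have l0 : (0 < l)%R by exact: lt_trans l1.
have lr : (l * r = r + e / 2)%R.
  by rewrite /l; field; rewrite gt_eqF.
have up : \forall t \near +oo%R, (t * G (s * b t) <= (r + e) * (t * G (b (l * t))))%R.
  have H0 : (0 < (r + e) * (l^-1 * c) - r * c)%R.
    rewrite mulrA -mulrBl mulr_gt0// subr_gt0 ltr_pdivlMr// mulrC lr; lra.
  near=> t; rewrite -subr_ge0; near: t.
  exact: (cvgr_ge _ (cvgB (cvgM (cvg_cst (r + e)%R) (G1l l l0)) (Gcvg s s0)) _ H0).
have dn : \forall t \near +oo%R, ((r - e) * (t * G (b t)) <= t * G (s * b (l * t)))%R.
  have H0 : (0 < l^-1 * (r * c) - (r - e) * c)%R.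
    rewrite mulrA -mulrBl mulr_gt0// subr_gt0 mulrC ltr_pdivlMr// mulrBl mulrC lr.
    have er0 : (0 < e / (2 * r))%R by rewrite divr_gt0// mulr_gt0.
    by rewrite mulrC /l; nra.
  near=> t; rewrite -subr_ge0; near: t.
  exact: (cvgr_ge _ (cvgB (Gl s l s0 l0) (cvgM (cvg_cst (r - e)%R) G1cvg)) _ H0).
have [M [_ HM]] := filterI up dn.
have := eventually_bracketed (Num.max (M + 1) 1)%R l1.
apply: filterS => x [t].
rewrite ge_max => /andP[Mt t1] /andP[bx xb].
have t0 : (0 < t)%R by exact: lt_le_trans t1.
have [|tup tdn] := HM t; first by apply: lt_le_trans Mt; rewrite ltrDl.
have sx : (s * b t <= s * x <= s * b (l * t))%R by rewrite !ler_pM2l// bx ltW.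
rewrite ler_distlC; apply/andP; split.
  have [re|re] := leP (r - e)%R 0%R; first by rewrite (le_trans re)// divr_ge0 ?ltW.
  rewrite ler_pdivlMr//; apply: (@le_trans _ _ ((r - e) * G (b t))%R).
    by rewrite ler_pM2l//; exact: Gni.
  apply: (@le_trans _ _ (G (s * b (l * t)))%R).
    by rewrite -(ler_pM2l t0) mulrCA.
  by apply: Gni; case/andP: sx.
rewrite ler_pdivrMr//; apply: (@le_trans _ _ (G (s * b t))%R).
  by apply: Gni; case/andP: sx.
apply: (@le_trans _ _ ((r + e) * G (b (l * t)))%R).
  by rewrite -(ler_pM2l t0) [leRHS]mulrCA.
by rewrite ler_pM2l ?addr_gt0//; apply: Gni; exact: ltW.
Unshelve. all: end_near. Qed.

End tail_inversion.

(** * Vague convergence on the quadrant *)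

Lemma rel_interiorE (T : topologicalType) (E A : set T) :
  exists2 V : set T, open V & rel_interior E A = A `&` V.
Proof.
exists (\bigcup_(U in [set U | open U /\ U `&` E `<=` A]) U).
  by apply: bigcup_open => U [].
by apply/seteqP; split=> [x [Ax [U [oU Ux UE]]]|x [Ax [U [oU UE] Ux]]];
  split=> //; exists U.
Qed.

(** Near a point outside [N], [A] either fills [E], making the point relatively interior, or is
    empty, which is impossible in the closure. *)
Lemma rel_boundary_sub (T : topologicalType) (E A N : set T) :
  (forall p, closure A p -> E p -> ~ N p ->
    (\forall q \near p, E q -> A q) \/ (\forall q \near p, ~ A q)) ->
  rel_boundary E A `<=` N.
Proof.
move=> H p [[clp Ep] nint]; apply: contrapT => Np; case: (H p clp Ep Np) => Hp.
  apply: nint; split; first exact: (nbhs_singleton Hp).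
  move: Hp; rewrite -nbhs_nearE nbhsE => -[U [oU Up] UA].
  by exists U; split=> // q [Uq Eq]; exact: UA.
by have [q [Aq]] := clp _ Hp.
Qed.

Lemma measurable_rel_boundary (R : realType) (E A : set (\bar R)) :
  measurable E -> measurable A -> measurable (rel_boundary E A).
Proof.
move=> mE mA; apply: measurableD.
  apply: measurableI => //; rewrite -[closure A]setCK; apply: measurableC.
  by apply: open_emeasurable; exact/closed_openC/closed_closure.
have [V oV ->] := rel_interiorE E A.
by apply: measurableI => //; exact: open_emeasurable.
Qed.

Lemma measurable_prod_rel_boundary (R : realType) (E A : set (\bar R * \bar R)) :
  measurable E -> measurable A -> measurable (rel_boundary E A).
Proof.
move=> mE mA; apply: measurableD.
  apply: measurableI => //; rewrite -[closure A]setCK; apply: measurableC.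
  by apply: open_prod_emeasurable; exact/closed_openC/closed_closure.
have [V oV ->] := rel_interiorE E A.
by apply: measurableI => //; exact: open_prod_emeasurable.
Qed.

Section quadrant.
Context {R : realType}.
Implicit Types (A : set (\bar R * \bar R)) (e : R).

Lemma measurable_quadrant : measurable (quadrant R).
Proof.
apply: (@measurableI _ _ [set p | 0 <= p.1] [set p | 0 < p.2]).
  rewrite -[X in measurable X]setTI.
  by apply: emeasurable_fun_c_infty => //; exact: measurable_fst.
rewrite -[X in measurable X]setTI.
by apply: emeasurable_fun_o_infty => //; exact: measurable_snd.
Qed.

Lemma closure_quadrant_ge A e : A `<=` quadrant R ->
  (forall p, A p -> e%:E <= p.2) ->
  closure A `<=` [set p | 0 <= p.1 /\ e%:E <= p.2].
Proof.
move=> AQ Ae.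
have cl : closed [set p : \bar R * \bar R | 0 <= p.1 /\ e%:E <= p.2].
  apply: (@closedI _ [set p | 0 <= p.1] [set p | e%:E <= p.2]).
    apply: ((continuous_closedP fst).1 _ [set x | 0 <= x]); last exact: closed_ereal_le_ereal.
    by move=> p; exact: cvg_fst.
  apply: ((continuous_closedP snd).1 _ [set x | e%:E <= x]); last exact: closed_ereal_le_ereal.
  by move=> p; exact: cvg_snd.
rewrite ((closure_id _).1 cl); apply: closureS => p Ap.
by split; [case: (AQ p Ap)|exact: Ae].
Qed.

(** The ambient space is compact and the edges at [x = 0] and at infinity belong to the quadrant, so
    only the edge [y = 0] has to be avoided. *)
Lemma rel_compact_quadrant A e : (0 < e)%R -> A `<=` quadrant R ->
  (forall p, A p -> e%:E <= p.2) -> rel_compact (quadrant R) A.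
Proof.
move=> e0 AQ Ae; have clA := closure_quadrant_ge AQ Ae; split.
  apply: (@subclosed_compact _ _ [set: \bar R * \bar R]) => //.
    exact: closed_closure.
  by rewrite -setXTT; apply: compact_setX; exact: ereal_compact.
by move=> p /clA[p1 p2]; split=> //; rewrite (lt_le_trans _ p2)// lte_fin.
Qed.

Lemma near_fst_gt (x : \bar R) (p : \bar R * \bar R) :
  x < p.1 -> \forall q \near p, x < q.1.
Proof.
move=> xp; have : nbhs p.1 [set y | x < y].
  by apply: open_nbhs_nbhs; split=> //; exact: open_ereal_gt_ereal.
exact: cvg_fst.
Qed.

Lemma near_fst_lt (x : \bar R) (p : \bar R * \bar R) :
  p.1 < x -> \forall q \near p, q.1 < x.
Proof.
move=> xp; have : nbhs p.1 [set y | y < x].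
  by apply: open_nbhs_nbhs; split=> //; exact: open_ereal_lt_ereal.
exact: cvg_fst.
Qed.

Lemma near_snd_gt (x : \bar R) (p : \bar R * \bar R) :
  x < p.2 -> \forall q \near p, x < q.2.
Proof.
move=> xp; have : nbhs p.2 [set y | x < y].
  by apply: open_nbhs_nbhs; split=> //; exact: open_ereal_gt_ereal.
exact: cvg_snd.
Qed.

(** A finite positive second factor rules out the indeterminate product of zero and infinity. *)
Lemma mule_continuous_at (p : \bar R * \bar R) : 0 < p.2 -> p.2 != +oo ->
  q.1 * q.2 @[q --> p] --> p.1 * p.2.
Proof.
move=> p0 poo; apply: cvgeM; [|exact: cvg_fst|exact: cvg_snd].
by case: p p0 poo => [[x| |] [y| |]]//=; rewrite lte_fin => y0 _; rewrite gt_eqF.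
Qed.
End quadrant.

(** * Tails of a limit measure along a function *)

Section level_tail.
Context {R : realType} d (T : measurableType d) (m : {measure set T -> \bar R}).
Variables (D : set T) (f : T -> \bar R) (k : R) (b G : R -> R).
Hypothesis mD : measurable D.
Hypothesis mf : measurable_fun setT f.

Definition level_tail (z : R) : set T := D `&` [set x | z%:E < f x].

Lemma measurable_level_tail z : measurable (level_tail z).
Proof.
apply: measurableI => //; rewrite -[X in measurable X]setTI.
exact: emeasurable_fun_o_infty.
Qed.

Lemma measurable_level y : measurable (D `&` f @^-1` [set y]).
Proof.
by apply: measurableI => //; rewrite -[_ @^-1` _]setTI; apply: mf.
Qed.

Hypothesis fin : forall z : R, (0 < z)%R -> m (level_tail z) < +oo.

Let finN z : (0 < z)%R -> m (level_tail z) \is a fin_num.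
Proof. by move=> z0; rewrite ge0_fin_numE// fin. Qed.

Let H z := fine (m (level_tail z)).

Let Hni (x y : R) : (0 < x)%R -> (x <= y)%R -> (H y <= H x)%R.
Proof.
move=> x0 xy; apply: fine_le; rewrite ?finN ?(lt_le_trans x0)//.
apply: le_measure; rewrite ?inE; [exact: measurable_level_tail..|].
by move=> p [Dp /=]; split=> //=; apply: le_lt_trans _ b0; rewrite lee_fin.
Qed.

(** Continuity from below of [m]: the tails at [z + 1/(n+1)] increase to the tail at [z]. *)
Let Hright (z e : R) : (0 < z)%R -> (0 < e)%R ->
  exists2 z', (z < z')%R & (H z <= H z' + e)%R.
Proof.
move=> z0 e0.
have zn n : (z < z + n.+1%:R^-1)%R by rewrite ltrDl invr_gt0.
have : m (level_tail (z + n.+1%:R^-1)) @[n --> \oo] --> m (level_tail z).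
  have -> : level_tail z = \bigcup_n level_tail (z + n.+1%:R^-1).
    apply/seteqP; split=> [p [Dp /= zp]|p [n _ [Dp /= zp]]]; last first.
      by split=> //=; apply: lt_trans zp; rewrite lte_fin.
    suff [n zfn] : exists n, (z + n.+1%:R^-1)%:E < f p by exists n.
    move: zp; case: (f p) => [r| |//]; last by exists 0%N; rewrite ltry.
    rewrite lte_fin => zr; exists (Num.truncn (r - z)^-1).
    rewrite lte_fin -ltrBrDl invf_plt ?posrE ?subr_gt0//.
    exact: truncnS_gt.
  apply: nondecreasing_cvg_mu.
  - by move=> n; exact: measurable_level_tail.
  - by apply: bigcup_measurable => n _; exact: measurable_level_tail.
  - move=> i j ij; apply/subsetPset => p [Dp /= ip]; split=> //=.
    by apply: le_lt_trans ip; rewrite lee_fin lerD2l lef_pV2 ?posrE// ler_nat.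
rewrite -(fineK (finN z0)) => /fine_cvg /cvgr_ge /(_ (H z - e)%R).
rewrite ltrBlDr ltrDl => /(_ e0)[n _ /(_ n (leqnn n))].
rewrite /= lerBlDr => h.
by exists (z + n.+1%:R^-1)%R.
Qed.

Hypothesis k0 : (0 < k)%R.
Hypothesis b0 : forall t : R, (0 < t)%R -> (0 < b t)%R.
Hypothesis bRV : forall s : R, (0 < s)%R ->
  (b (s * t) / b t)%R @[t --> +oo%R] --> (s `^ k)%R.
Hypothesis Gni : {homo G : x y /~ (x <= y)%R}.
Hypothesis Gcvg : forall w : R, (0 < w)%R -> m (D `&` f @^-1` [set w%:E]) = 0 ->
  (t * G (w * b t))%R @[t --> +oo%R] --> fine (m (level_tail w)).

Lemma level_tail_powR (z : R) : (0 < z)%R ->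
  fine (m (level_tail z)) = (z `^ (- k^-1) * fine (m (level_tail 1)))%R.
Proof.
move=> z0.
pose C := [set w : R | m (D `&` f @^-1` [set w%:E]) = 0].
apply: (@tail_powR _ k b G k0 b0 bRV Gni H C Hni Hright _ Gcvg _ z0) => u v u0 uv.
have [w /andP[uw wv] w0] := null_level_between (measurable_level_tail u) (fin u0) mf uv.
exists w; first by rewrite uw wv.
(* The fibre over [w > u] already lies in the tail above [u], so being null there is being null in
   [D]. *)
rewrite /C /= -[RHS]w0; congr (m _); apply/seteqP; split=> p /=.
  by move=> [Dp fp]; rewrite fp; do 2!split=> //=; rewrite fp lte_fin.
by move=> [[Dp _] fp].
Qed.

Let tail_scale (s z : R) : (0 < s)%R -> (0 < z)%R -> H (s `^ k * z)%R = (s^-1 * H z)%R.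
Proof.
move=> s0 z0; have sk0 : (0 < s `^ k)%R by exact: powR_gt0.
rewrite /H level_tail_powR ?mulr_gt0// [in RHS]level_tail_powR//.
rewrite powRM ?ltW// -powRrM mulrN mulfV ?gt_eqF// powR_inv1 ?ltW//.
by rewrite mulrA.
Qed.

(** A charged level would be a jump of the tail, whereas a power function is continuous. *)
Lemma level_null (z : R) : (0 < z)%R -> m (D `&` f @^-1` [set z%:E]) = 0.
Proof.
move=> z0; apply/eqP; rewrite eq_le measure_ge0 andbT.
apply/lee_addgt0Pr => e e0; rewrite add0e.
(* [s] is chosen so that lowering the level by the factor [s^k] multiplies the
   tail by exactly [1 + eta]. *)
pose eta := (e / (H z + 1))%R.
have Hz0 : (0 <= H z)%R by exact: fine_ge0.
have eta0 : (0 < eta)%R by rewrite divr_gt0// ltr_wpDl.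
pose s := (1 + eta)^-1%R.
have s0 : (0 < s)%R by rewrite invr_gt0 addr_gt0.
pose z' := (s `^ k * z)%R.
have z'0 : (0 < z')%R by rewrite mulr_gt0// powR_gt0.
have z'z : (z' < z)%R.
  rewrite gtr_pMl//; have := @gt0_ltr_powR R k k0 s 1%R; rewrite powR1 !nnegrE.
  by apply; rewrite ?ltW// /s invf_lt1 ?addr_gt0// ltrDl.
have : m (D `&` f @^-1` [set z%:E]) + m (level_tail z) <= m (level_tail z').
  rewrite -measureU//=.
  - apply: le_measure; rewrite ?inE.
    + by apply: measurableU; [exact: measurable_level|exact: measurable_level_tail].
    + exact: measurable_level_tail.
    move=> p [[Dp /= fp]|[Dp /= fp]]; split=> //=; first by rewrite fp lte_fin.
    by apply: lt_trans fp; rewrite lte_fin.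
  - exact: measurable_level.
  - exact: measurable_level_tail.
  - by rewrite -subset0 => p [[_ /= fp] [_ /=]]; rewrite fp ltxx.
rewrite -(fineK (finN z0)) -(fineK (finN z'0)) -leeBrDr// -EFinB.
move=> /le_trans; apply; rewrite lee_fin -/(H z) -/(H z') tail_scale//.
rewrite /s invrK mulrDl mul1r [(H z + _)%R]addrC addrK.
by rewrite /eta mulrAC ler_pdivrMr ?ltr_wpDl// ler_pM2l// lerDl.
Qed.

(** The tail at level [s^k] is [H 1 / s], which is below [e] once [s = (H 1 + 1) / e]. *)
Lemma level_pinfty_null : m (D `&` f @^-1` [set +oo]) = 0.
Proof.
apply/eqP; rewrite eq_le measure_ge0 andbT.
apply/lee_addgt0Pr => e e0; rewrite add0e.
have H10 : (0 <= H 1)%R by exact: fine_ge0.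
pose s := ((H 1 + 1) / e)%R.
have s0 : (0 < s)%R by rewrite divr_gt0// ltr_wpDl.
have sk0 : (0 < s `^ k)%R by exact: powR_gt0.
apply: (@le_trans _ _ (m (level_tail (s `^ k)))).
  apply: le_measure; rewrite ?inE.
  - exact: measurable_level.
  - exact: measurable_level_tail.
  - by move=> p [Dp /= fp]; split=> //=; rewrite fp ltry.
rewrite -(fineK (finN sk0)) lee_fin -/(H _) -(mulr1 (s `^ k))%R tail_scale//.
by rewrite /s invf_div mulrAC ler_pdivrMr ?ltr_wpDl// ler_pM2l// lerDl.
Qed.

Lemma level_tail_cvg (w : R) : (0 < w)%R ->
  (t * G (w * b t))%R @[t --> +oo%R] -->
  (w `^ (- k^-1) * fine (m (level_tail 1)))%R.
Proof.
by move=> w0; rewrite -level_tail_powR//; apply: Gcvg => //; exact: level_null.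
Qed.

End level_tail.

(** * Image measures, limits superior and the inverted variables *)

Lemma restricted_pushforward (R : realType) d1 d2 (T1 : measurableType d1)
    (T2 : measurableType d2) (m : {measure set T1 -> \bar R}) (D : set T1)
    (f : T1 -> T2) :
  measurable D -> measurable_fun setT f ->
  exists nu : {measure set T2 -> \bar R}, forall A, nu A = m (D `&` f @^-1` A).
Proof.
move=> mD mf; unshelve eexists.
  refine (pushforward (mrestr m mD) f : {measure set T2 -> \bar R}); exact: mf.
by move=> A; rewrite /= /pushforward /mrestr setIC.
Qed.

Lemma limf_esup_lt (R : realType) (T : topologicalType) (F : set_system T)
    (f : T -> \bar R) (l : \bar R) :
  limf_esup f F < l -> exists2 A, F A & forall x, A x -> f x < l.
Proof.
rewrite limf_esupE => /ereal_inf_lt[_ [A FA <-] Al]; exists A => // x Ax.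
by apply: le_lt_trans Al; apply: ereal_sup_ubound; exists x.
Qed.

Lemma tilde_gt0 (R : realType) (x : R) : 0 < tilde x.
Proof.
rewrite /tilde; case: ifPn => [x0|_]; last exact: lt0y.
by rewrite lte_fin oppr_gt0 invr_lt0.
Qed.

Lemma measurable_tilde (R : realType) : measurable_fun setT (@tilde R).
Proof.
apply: measurable_fun_if => //.
  exact: measurable_fun_ltr.
have -> : [set: R] `&` (fun x : R => (x < 0)%R) @^-1` [set true] = `]-oo, 0%R[%classic.
  by apply/seteqP; split=> x /=; rewrite in_itv/= => // -[].
apply/measurable_EFinP; apply: measurable_funN.
apply: open_continuous_measurable_fun => // x.
by rewrite inE/= in_itv/= => x0; apply: inv_continuous; rewrite lt_eqF.
Qed.

(** The two signs cancel, and the value [+oo] at a zero factor is consistent because [tilde] is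
    strictly positive. *)
Lemma inv_prodE (R : realType) (x y : R) : (x <= 0)%R -> (y <= 0)%R ->
  inv_prod x y = tilde x * tilde y.
Proof.
move=> x0 y0; rewrite /inv_prod; case: ifPn => [|xy0].
  rewrite mulf_eq0 negb_or => /andP[nx ny].
  rewrite /tilde !lt_neqAle nx ny x0 y0/= -EFinM; congr EFin.
  by rewrite mulrNN invfM.
move: (tilde_gt0 x) (tilde_gt0 y).
rewrite negbK mulf_eq0 in xy0; case/orP : xy0 => /eqP ->.
  by rewrite {1 3}/tilde ltxx => _ y1; rewrite gt0_mulye.
by rewrite {2 4}/tilde ltxx => x1 _; rewrite gt0_muley.
Qed.

(** * The product tail *)

Section product_tail.
Context {R : realType} d (T : measurableType d) (P : probability T R).
Variables (U V : T -> \bar R) (alpha a : R -> R) (kx ky : R).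
Variable mu : {measure set (\bar R * \bar R) -> \bar R}.
Hypothesis mU : measurable_fun setT U.
Hypothesis mV : measurable_fun setT V.
Hypothesis U0 : forall w, 0 < U w.
Hypothesis V0 : forall w, 0 < V w.
Hypothesis kx0 : (0 < kx)%R.
Hypothesis ky0 : (0 < ky)%R.
Hypothesis alpha0 : forall t : R, (0 < t)%R -> (0 < alpha t)%R.
Hypothesis a0 : forall t : R, (0 < t)%R -> (0 < a t)%R.
Hypothesis alphaRV : forall s : R, (0 < s)%R ->
  (alpha (s * t) / alpha t)%R @[t --> +oo%R] --> (s `^ kx)%R.
Hypothesis aRV : forall s : R, (0 < s)%R ->
  (a (s * t) / a t)%R @[t --> +oo%R] --> (s `^ ky)%R.

Local Notation Q := (quadrant R).
Local Notation UV t w := (U w * ((alpha t)^-1)%:E, V w * ((a t)^-1)%:E).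

Hypothesis mu_fin : forall A, measurable A -> rel_compact Q A -> mu A < +oo.
Hypothesis muV : vague_cvg (measurable : set (set (\bar R * \bar R)%type)) Q
  (fun t A => t%:E * P [set w | A (UV t w)]) mu.
Hypothesis tailU : forall z eta : R, (0 < z)%R -> (0 < eta)%R ->
  exists2 delta : R, (0 < delta)%R & forall e : R, (0 < e)%R -> (e < delta)%R ->
    \forall t \near +oo%R,
      t%:E * P [set w | (z / e)%:E < U w * ((alpha t)^-1)%:E] <= eta%:E.

Let mUc (c : R) : measurable_fun setT (fun w => U w * c%:E).
Proof. exact: emeasurable_funM mU (measurable_cst _). Qed.

Let mVc (c : R) : measurable_fun setT (fun w => V w * c%:E).
Proof. exact: emeasurable_funM mV (measurable_cst _). Qed.

Let mUV t A : measurable A -> measurable [set w | A (UV t w)].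
Proof.
move=> mA; rewrite -[X in measurable X]setTI.
exact: (measurable_fun_pair (mUc _) (mVc _)).
Qed.

Let Ut0 t w : (0 < t)%R -> 0 < U w * ((alpha t)^-1)%:E.
Proof. by move=> t0; rewrite mule_gt0// lte_fin invr_gt0 alpha0. Qed.

Let Vt0 t w : (0 < t)%R -> 0 < V w * ((a t)^-1)%:E.
Proof. by move=> t0; rewrite mule_gt0// lte_fin invr_gt0 a0. Qed.

Let tP t (S : set T) : measurable S -> t%:E * P S = (t * fine (P S))%:E.
Proof. by move=> mS; rewrite EFinM fineK// fin_num_measure. Qed.

Let tP_le t (S S' : set T) : (0 < t)%R -> measurable S -> measurable S' ->
  S `<=` S' -> t%:E * P S <= t%:E * P S'.
Proof.
by move=> t0 mS mS' SS'; rewrite lee_pmul2l// le_measure// inE.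
Qed.

(** Working form of [muV]: boundedness away from [y = 0] gives relative compactness, and the null
    set [N] covers the relative boundary. *)
Lemma quadrant_cvg A N (e : R) : (0 < e)%R -> measurable A -> A `<=` Q ->
  (forall p, A p -> e%:E <= p.2) -> measurable N -> mu N = 0 ->
  (forall p, Q p -> e%:E <= p.2 -> ~ N p ->
    (\forall q \near p, Q q -> A q) \/ (\forall q \near p, ~ A q)) ->
  t%:E * P [set w | A (UV t w)] @[t --> +oo%R] --> mu A.
Proof.
move=> e0 mA AQ Ae mN N0 H; apply: muV => //.
  exact: rel_compact_quadrant e0 AQ Ae.
apply: (subset_measure0 _ mN _ N0).
  exact: measurable_prod_rel_boundary (@measurable_quadrant R) mA.
apply: rel_boundary_sub => p /(closure_quadrant_ge AQ Ae)[_ p2] Qp Np.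
exact: H.
Qed.

Let snd_fin (z : R) : (0 < z)%R -> mu (level_tail Q snd z) < +oo.
Proof.
move=> z0; apply: mu_fin.
  exact: measurable_level_tail (@measurable_quadrant R) (@measurable_snd _ _ _ _) _.
by apply: (rel_compact_quadrant z0) => [p []|p [_ /ltW]].
Qed.

Let GV (x : R) := fine (P [set w | x%:E < V w]).

Let mgt (f : T -> \bar R) (x : \bar R) : measurable_fun setT f -> measurable [set w | x < f w].
Proof.
by move=> mf; rewrite -[X in measurable X]setTI; exact: emeasurable_fun_o_infty.
Qed.

Let tail_ni (f : T -> \bar R) : measurable_fun setT f ->
  {homo (fun x : R => fine (P [set w | x%:E < f w])) : x y /~ (x <= y)%R}.
Proof.
move=> mf x y xy; apply: fine_le; rewrite ?fin_num_measure//; try exact: mgt.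
rewrite le_measure ?inE//; [exact: mgt..|].
by move=> w /=; apply: le_lt_trans; rewrite lee_fin.
Qed.

(** The half plane [y > w] is relatively compact with boundary on the line [y = w], and [U] is
    unconstrained there, so the joint limit yields the tail of [V] alone. *)
Let snd_cvg (w : R) : (0 < w)%R -> mu (Q `&` snd @^-1` [set w%:E]) = 0 ->
  (t * GV (w * a t))%R @[t --> +oo%R] --> fine (mu (level_tail Q snd w)).
Proof.
move=> w0 N0.
have mN := measurable_level (@measurable_quadrant R) (@measurable_snd _ _ _ _) w%:E.
have mA := measurable_level_tail (@measurable_quadrant R) (@measurable_snd _ _ _ _) w.
have : t%:E * P [set x | level_tail Q snd w (UV t x)] @[t --> +oo%R] -->
    mu (level_tail Q snd w).
  apply: (quadrant_cvg w0 mA _ _ mN N0); first by move=> p [].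
    by move=> p [_ /ltW].
  move=> p Qp wp Np; left.
  have : w%:E < p.2.
    by rewrite lt_neqAle wp andbT; apply/eqP => pw; apply: Np; split=> //=; rewrite pw.
  by move=> /near_snd_gt; apply: filterS => q wq Qq; split.
rewrite -[X in _ --> X](@fineK _ (mu _)) ?ge0_fin_numE ?snd_fin//.
move=> /fine_cvg; apply: cvg_trans; apply: near_eq_cvg; near=> t.
have t0 : (0 < t)%R by near: t; exact: nbhs_pinfty_gt.
rewrite /= tP; last exact: mUV.
rewrite /=; congr (_ * fine (P _))%R; apply/seteqP; split=> x /=.
  by move=> [_ /=]; rewrite lte_pdivlMr ?a0// -EFinM.
move=> wx; split; first by split=> /=; [exact/ltW/Ut0|exact: Vt0].
by rewrite /= lte_pdivlMr ?a0// -EFinM.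
Unshelve. all: end_near. Qed.

Let snd_null (z : R) : (0 < z)%R -> mu (Q `&` snd @^-1` [set z%:E]) = 0.
Proof.
exact: (level_null (@measurable_quadrant R) (@measurable_snd _ _ _ _) snd_fin
  ky0 a0 aRV (tail_ni mV) snd_cvg).
Qed.

Let snd_pinfty_null : mu (Q `&` snd @^-1` [set +oo]) = 0.
Proof.
exact: (level_pinfty_null (@measurable_quadrant R) (@measurable_snd _ _ _ _) snd_fin
  ky0 a0 aRV (tail_ni mV) snd_cvg).
Qed.

(** The bound passes from the tail of [U] to [mu] and does not depend on [e], so that [e] may later
    tend to [0]. *)
Lemma corner_bound (x x' e : R) : (x < x')%R -> (0 < e)%R ->
  (\forall t \near +oo%R,
     t%:E * P [set w | x%:E < U w * ((alpha t)^-1)%:E] <= 1) ->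
  mu [set p | [/\ Q p, x'%:E < p.1 & e%:E < p.2]] <= 1.
Proof.
move=> xx' e0 Ux.
have e20 : (0 < e / 2)%R by exact: divr_gt0.
have ee2 : (e / 2 < e)%R by rewrite ltr_pdivrMr// ltr_pMr// ltr1n.
have mS := measurable_level_tail (@measurable_quadrant R) (@measurable_snd _ _ _ _).
(* Some vertical lines may be charged, so an uncharged one is picked inside the strip [y > e/2],
   where [mu] is finite. *)
have [x0 /andP[xx0 x0x'] Nx0] := null_level_between (mS (e / 2)%R) (snd_fin e20)
  (@measurable_fst _ _ _ _) xx'.
pose A := level_tail (level_tail Q snd e) fst x0.
have mA : measurable A.
  exact: measurable_level_tail (mS e) (@measurable_fst _ _ _ _) x0.
pose N := (level_tail Q snd (e / 2) `&` fst @^-1` [set x0%:E]) `|`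
  (Q `&` snd @^-1` [set e%:E]).
have mN1 := measurable_level (mS (e / 2)%R) (@measurable_fst _ _ _ _) x0%:E.
have mN2 := measurable_level (@measurable_quadrant R) (@measurable_snd _ _ _ _) e%:E.
have mN : measurable N by exact: measurableU.
have N0 : mu N = 0.
  by rewrite measureU0// snd_null.
have cv : t%:E * P [set w | A (UV t w)] @[t --> +oo%R] --> mu A.
  apply: (quadrant_cvg e0 mA _ _ mN N0); first by move=> p [[]].
    by move=> p [[_ /ltW]].
  move=> p Qp ep Np.
  have ep' : e%:E < p.2.
    by rewrite lt_neqAle ep andbT; apply/eqP => pw; apply: Np; right; split=> //=; rewrite pw.
  have [px0|px0|px0] := ltgtP p.1 x0%:E.
  - by right; have := near_fst_lt px0; apply: filterS => q qx [_ /=]; rewrite ltNge ltW.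
  - by left; apply: filterS2 (near_fst_gt px0) (near_snd_gt ep') => q qx qe Qq.
  - exfalso; apply: Np; left; split=> //; split=> //=; apply: lt_trans ep'.
    by rewrite lte_fin.
apply: (@le_trans _ _ (mu A)).
  apply: le_measure; rewrite ?inE//.
    rewrite (_ : [set _ | _] = level_tail (level_tail Q snd e) fst x').
      exact: measurable_level_tail (mS e) (@measurable_fst _ _ _ _) x'.
    by apply/seteqP; split=> p [] // [].
  move=> p [Qp xp ep]; split=> //=; apply: lt_trans xp.
  by rewrite lte_fin.
apply: (cvge_to_le cv).
near=> t; have t0 : (0 < t)%R by near: t; exact: nbhs_pinfty_gt.
apply: (@le_trans _ _ (t%:E * P [set w | x%:E < U w * ((alpha t)^-1)%:E])).
  apply: tP_le => //; [exact: mUV|exact: mgt|].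
  by move=> w [_ /=]; apply: lt_trans; rewrite lte_fin.
by near: t.
Unshelve. all: end_near. Qed.

(** * Vague convergence of the law of the product *)

Let pr (p : \bar R * \bar R) := p.1 * p.2.

Let mpr : measurable_fun setT pr.
Proof. by apply: emeasurable_funM; [exact: measurable_fst|exact: measurable_snd]. Qed.

Let trunc_cvg B : measurable B -> B `<=` Q ->
  mu (level_tail B snd n.+1%:R^-1) @[n --> \oo] --> mu B.
Proof.
move=> mB BQ.
have mT n := measurable_level_tail mB (@measurable_snd _ _ _ _) n.+1%:R^-1.
have {2}-> : B = \bigcup_n level_tail B snd n.+1%:R^-1.
  apply/seteqP; split=> [p Bp|p [n _ []]//].
  have [_ p2] := BQ _ Bp.
  suff [n pn] : exists n, (n.+1%:R^-1 : R)%:E < p.2 by exists n.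
  move: p2; case: (p.2) => [r| |//]; last by exists 0%N; rewrite ltry.
  rewrite lte_fin => r0; exists (Num.truncn r^-1).
  by rewrite lte_fin invf_plt ?posrE// truncnS_gt.
apply: nondecreasing_cvg_mu => //.
  by apply: bigcup_measurable.
move=> i j ij; apply/subsetPset => p [Bp /= ip]; split=> //=.
by apply: le_lt_trans ip; rewrite lee_fin lef_pV2 ?posrE// ler_nat.
Qed.

(** The region [xy > z] reaches the edge [y = 0], so finiteness is not given. Its part [y > e] is a
    finite strip; its part [y <= e] has [x > z/e] and is bounded by [corner_bound], uniformly in the
    truncation [y > h]. *)
Lemma prod_tail_fin (z : R) : (0 < z)%R -> mu (level_tail Q pr z) < +oo.
Proof.
move=> z0; have z20 : (0 < z / 2)%R by exact: divr_gt0.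
(* Using [z/2] leaves the gap between [z/(2e)] and [z/e] that [corner_bound] needs. *)
have [delta delta0 Hd] := tailU z20 (@ltr01 R).
pose e := (delta / 2)%R.
have e0 : (0 < e)%R by exact: divr_gt0.
have ed : (e < delta)%R by rewrite /e ltr_pdivrMr// ltr_pMr// ltr1n.
have Ue := Hd e e0 ed.
have xx' : (z / 2 / e < z / e)%R.
  by rewrite ltr_pM2r ?invr_gt0// ltr_pdivrMr// ltr_pMr// ltr1n.
have mS := measurable_level_tail (@measurable_quadrant R) (@measurable_snd _ _ _ _).
have mprt := measurable_level_tail (@measurable_quadrant R) mpr z.
apply: (@le_lt_trans _ _ (mu (level_tail Q snd e) + 1)).
  2: by rewrite lte_add_pinfty ?ltry// snd_fin.
have QQ : level_tail Q pr z `<=` Q by move=> p [].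
apply: (cvge_to_le (trunc_cvg mprt QQ)).
near=> n; set h := (n.+1%:R^-1)%R; have h0 : (0 < h)%R by rewrite invr_gt0.
pose C := [set p | [/\ Q p, (z / e)%:E < p.1 & h%:E < p.2]].
have mC : measurable C.
  rewrite (_ : C = level_tail (level_tail Q snd h) fst (z / e)).
    exact: measurable_level_tail (mS h) (@measurable_fst _ _ _ _) (z / e)%R.
  by apply/seteqP; split=> p [] // [].
apply: (@le_trans _ _ (mu (level_tail Q snd e `|` C))).
  apply: le_measure; rewrite ?inE.
  - exact: measurable_level_tail mprt (@measurable_snd _ _ _ _) h.
  - by apply: measurableU => //; exact: mS.
  move=> p [[Qp /= zp] /= hp]; have [ep|pe] := ltP e%:E p.2; first by left.
  right; split=> //; rewrite ltNge; apply/negP => pze.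
  move: zp; rewrite ltNge => /negP; apply.
  rewrite (_ : z%:E = (z / e)%:E * e%:E); last by rewrite -EFinM divfK ?gt_eqF.
  by case: Qp => p1 p2; apply: lee_pmul => //; exact: ltW.
apply: (le_trans (measureU2 mu (mS e) mC)).
by rewrite leeD2l// (corner_bound xx' h0 Ue).
Unshelve. all: end_near. Qed.

(** Truncation to [y > h] costs little for [mu] by continuity from below, and little for the
    prelimit laws by [tailU]; between the truncated quantities [muV] applies. *)
Lemma prod_vague (A : set (\bar R)) (z : R) : (0 < z)%R -> measurable A ->
  A `<=` [set x | z%:E < x] -> closure A `<=` posline R ->
  mu (Q `&` pr @^-1` rel_boundary (posline R) A) = 0 ->
  t%:E * P [set w | A (pr (UV t w))] @[t --> +oo%R] --> mu (Q `&` pr @^-1` A).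
Proof.
move=> z0 mA Az clA bA0.
have mprA (B : set (\bar R)) : measurable B -> measurable (Q `&` pr @^-1` B).
  move=> mB; apply: measurableI; first exact: measurable_quadrant.
  by rewrite -[X in measurable X]setTI; exact: mpr.
have mpos : measurable (posline R).
  by rewrite /posline -[X in measurable X]setTI; apply: emeasurable_fun_o_infty.
set L := Q `&` pr @^-1` A.
have mL : measurable L by exact: mprA.
have LQ : L `<=` Q by move=> p [].
have Lfin : mu L \is a fin_num.
  rewrite ge0_fin_numE//; apply: le_lt_trans (prod_tail_fin z0).
  apply: le_measure; rewrite ?inE//.
    exact: measurable_level_tail (@measurable_quadrant R) mpr z.
  by move=> p [Qp /Az].
have mLe e : measurable (level_tail L snd e).
  exact: measurable_level_tail mL (@measurable_snd _ _ _ _) e.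
have Le_cvg (e : R) : (0 < e)%R ->
    t%:E * P [set w | level_tail L snd e (UV t w)] @[t --> +oo%R] -->
    mu (level_tail L snd e).
  move=> e0.
  (* Three sources of boundary: that of [A] itself, the cut [y = e], and the line [y = +oo], on
     which continuity of the product can fail. *)
  pose N := (Q `&` pr @^-1` rel_boundary (posline R) A) `|`
    (Q `&` snd @^-1` [set e%:E]) `|` (Q `&` snd @^-1` [set +oo]).
  have mNA : measurable (Q `&` pr @^-1` rel_boundary (posline R) A).
    by apply: mprA; apply: measurable_rel_boundary.
  have mNs y := measurable_level (@measurable_quadrant R) (@measurable_snd _ _ _ _) y.
  apply: (@quadrant_cvg _ N _ e0 (mLe e)).
  - by move=> p [[]].
  - by move=> p [_ /ltW].
  - by apply: measurableU => //; exact: measurableU.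
  - rewrite /N measureU0//; last exact: measurableU.
    by rewrite measureU0// snd_null.
  move=> p Qp ep Np.
  have ep' : e%:E < p.2.
    rewrite lt_neqAle ep andbT; apply/eqP => pw; apply: Np.
    by left; right; split=> //=; rewrite pw.
  have poo : p.2 != +oo by apply/eqP => poo; apply: Np; right.
  have [p10 p20] := Qp.
  have prc := mule_continuous_at p20 poo.
  have [clp|nclp] := pselect (closure A (pr p)).
    left; have prp0 := clA _ clp.
    have [intp|nint] := pselect (rel_interior (posline R) A (pr p)); last first.
      by exfalso; apply: Np; left; left.
    have [_ [W [oW Wp WA]]] := intp.
    have nW : \forall q \near p, W (pr q).
      by apply: prc; apply: open_nbhs_nbhs.
    have n0 : \forall q \near p, 0 < pr q.
      apply: (prc [set y | 0 < y]); apply: open_nbhs_nbhs; split=> //.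
      exact: open_ereal_gt_ereal.
    apply: filterS3 nW n0 (near_snd_gt ep') => q Wq q0 eq Qq.
    by split=> //; split=> //; apply: WA.
  right; have : \forall q \near p, (~` closure A) (pr q).
    apply: (prc (~` closure A)); apply: open_nbhs_nbhs; split=> //.
    exact/closed_openC/closed_closure.
  by apply: filterS => q ncl [[_ Aq] _]; apply/ncl/subset_closure.
have Lefin e : mu (level_tail L snd e) \is a fin_num.
  rewrite ge0_fin_numE//; apply: (@le_lt_trans _ _ (mu L)).
    by apply: le_measure; rewrite ?inE// => p [].
  by rewrite -ge0_fin_numE.
have mPA t : measurable [set w | A (pr (UV t w))].
  rewrite -[X in measurable X]setTI.
  by apply: (measurableT_comp mpr (measurable_fun_pair (mUc _) (mVc _))).
apply: (@cvg_trans _ ((t * fine (P [set w | A (pr (UV t w))]))%:E @[t --> +oo%R])).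
  by apply: near_eq_cvg; near=> t; rewrite tP.
rewrite -(fineK Lfin); apply: cvg_EFin; first exact: nearW.
apply/cvgrPdist_le => e e0; have e30 : (0 < e / 3)%R by exact: divr_gt0.
have [delta delta0 Hd] := tailU z0 e30.
have := trunc_cvg mL LQ; rewrite -(fineK Lfin) => /fine_cvg/cvgrPdist_le/(_ _ e30) cL.
have : \forall n \near \oo, (n.+1%:R^-1 < delta)%R.
  exact: near_infty_natSinv_lt (PosNum delta0).
move=> /(filterI cL)[n _ /(_ n (leqnn n))[/= cLn hd]].
set h := (n.+1%:R^-1)%R in cLn hd; have h0 : (0 < h)%R by rewrite invr_gt0.
have := Le_cvg h h0; rewrite -(fineK (Lefin h)) => /fine_cvg/cvgrPdist_le/(_ _ e30) cLh.
near=> t; have t0 : (0 < t)%R by near: t; exact: nbhs_pinfty_gt.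
have cLht : (`|fine (mu (level_tail L snd h)) -
  fine (t%:E * P [set w | level_tail L snd h (UV t w)])| <= e / 3)%R by near: t.
rewrite tP in cLht; last exact: mUV.
rewrite /= in cLht.
have Ut : t%:E * P [set w | (z / h)%:E < U w * ((alpha t)^-1)%:E] <= (e / 3)%:E.
  by near: t; exact: Hd.
rewrite tP in Ut; last exact: mgt.
rewrite lee_fin in Ut.
have lo : t%:E * P [set w | level_tail L snd h (UV t w)] <=
          t%:E * P [set w | A (pr (UV t w))].
  by apply: tP_le => //; [exact: mUV|move=> w [[]]].
have hi : t%:E * P [set w | A (pr (UV t w))] <=
          t%:E * P [set w | level_tail L snd h (UV t w)] +
          t%:E * P [set w | (z / h)%:E < U w * ((alpha t)^-1)%:E].
  rewrite -ge0_muleDr// lee_pmul2l//; apply: le_trans (measureU2 P (mUV _ (mLe h)) (mgt _ (mUc _))).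
  apply: le_measure; rewrite ?inE//.
      by apply: measurableU; [exact: mUV|exact: mgt].
    move=> w Aw; have [hV|Vh] := ltP h%:E (V w * ((a t)^-1)%:E).
      by left; split=> //; split=> //; split=> /=; [exact/ltW/Ut0|exact: Vt0].
    (* If also [U <= z/h] after scaling, the product would be at most [z]. *)
    right; rewrite /= ltNge; apply/negP => Uz.
    have := Az _ Aw; rewrite /= ltNge => /negP; apply.
    rewrite (_ : z%:E = (z / h)%:E * h%:E); last by rewrite -EFinM divfK ?gt_eqF.
    by apply: lee_pmul => //; apply: ltW; [exact: Ut0|exact: Vt0].
rewrite (tP t (mUV t (mLe h))) (tP t (mPA t)) lee_fin in lo.
rewrite (tP t (mUV t (mLe h))) (tP t (mPA t)) (tP t (mgt _ (mUc _))) -EFinD lee_fin in hi.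
move: cLn cLht; rewrite !ler_norml => /andP[c1 c2] /andP[c3 c4].
by apply/andP; split; lra.
Unshelve. all: end_near. Qed.

(** * Power tail of the product and its limit measure *)

Let mprod_tail z : measurable (level_tail Q pr z).
Proof. exact: measurable_level_tail (@measurable_quadrant R) mpr z. Qed.

Let mposline : measurable (posline R).
Proof.
by rewrite /posline -[X in measurable X]setTI; apply: emeasurable_fun_o_infty.
Qed.

Let scale_prod t w :
  pr (UV t w) = U w * V w * ((alpha t * a t)^-1)%:E.
Proof. by rewrite /pr /= muleACA invfM EFinM. Qed.

Let ab0 (t : R) : (0 < t)%R -> (0 < alpha t * a t)%R.
Proof. by move=> t0; rewrite mulr_gt0 ?alpha0 ?a0. Qed.

Let abRV (s : R) : (0 < s)%R ->
  (alpha (s * t) * a (s * t) / (alpha t * a t))%R @[t --> +oo%R] -->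
  (s `^ (kx + ky))%R.
Proof.
move=> s0; rewrite powRD; last by rewrite gt_eqF ?addr_gt0.
under eq_fun do rewrite invfM mulrACA.
exact: cvgM (alphaRV s0) (aRV s0).
Qed.

Let k0 : (0 < kx + ky)%R. Proof. exact: addr_gt0. Qed.

Let mUV_prod : measurable_fun setT (fun w => U w * V w).
Proof. exact: emeasurable_funM. Qed.

Let GUV (x : R) := fine (P [set w | x%:E < U w * V w]).

(** The relative boundary of the half line above [z] lies in the single point [z], so [prod_vague]
    applies at every uncharged level. *)
Let prod_cvg (z : R) : (0 < z)%R -> mu (Q `&` pr @^-1` [set z%:E]) = 0 ->
  (t * GUV (z * (alpha t * a t)))%R
    @[t --> +oo%R] --> fine (mu (level_tail Q pr z)).
Proof.
move=> z0 N0.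
have clz : closure [set x | z%:E < x] `<=` [set x : \bar R | z%:E <= x].
  have := @closed_ereal_le_ereal R z%:E => /closure_id ->.
  by apply: closureS => x /ltW.
have mA : measurable [set x : \bar R | z%:E < x].
  by rewrite -[X in measurable X]setTI; apply: emeasurable_fun_o_infty.
have : t%:E * P [set w | z%:E < pr (UV t w)] @[t --> +oo%R] -->
    mu (level_tail Q pr z).
  apply: (prod_vague z0 mA) => //.
    by move=> x /clz /=; apply: lt_le_trans; rewrite lte_fin.
  apply: (subset_measure0 _ (measurable_level (@measurable_quadrant R) mpr z%:E) _ N0).
    apply: measurableI; first exact: measurable_quadrant.
    rewrite -[X in measurable X]setTI; apply: mpr => //.
    exact: measurable_rel_boundary.
  apply: setIS; apply: preimage_subset; apply: rel_boundary_sub => x /clz /= zx _ xz.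
  have zx' : z%:E < x by rewrite lt_neqAle zx andbT; apply/eqP => /esym.
  left; have : nbhs x [set y | z%:E < y].
    by apply: open_nbhs_nbhs; split=> //; exact: open_ereal_gt_ereal.
  by apply: filterS.
rewrite -[X in _ --> X](@fineK _ (mu _)) ?ge0_fin_numE ?prod_tail_fin//.
move=> /fine_cvg; apply: cvg_trans; apply: near_eq_cvg; near=> t.
have t0 : (0 < t)%R by near: t; exact: nbhs_pinfty_gt.
have e : [set w | z%:E < pr (UV t w)] =
    [set w | (z * (alpha t * a t))%:E < U w * V w].
  by apply/seteqP; split=> w; rewrite /mkset scale_prod lte_pdivlMr ?ab0// -EFinM.
suff : fine (t%:E * P [set w | z%:E < pr (UV t w)]) =
  (t * GUV (z * (alpha t * a t)))%R by [].
by rewrite e tP//; exact: mgt.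
Unshelve. all: end_near. Qed.

Let c := fine (mu (level_tail Q pr 1)).

Let prod_tail_cvg (z : R) : (0 < z)%R ->
  (t * GUV (z * (alpha t * a t)))%R
    @[t --> +oo%R] --> (z `^ (- (kx + ky)^-1) * c)%R.
Proof.
exact: (level_tail_cvg (@measurable_quadrant R) mpr prod_tail_fin k0 ab0 abRV
  (tail_ni mUV_prod) prod_cvg).
Qed.

Let prod_tailE (z : R) : (0 < z)%R ->
  mu (level_tail Q pr z) = (z `^ (- (kx + ky)^-1) * c)%:E.
Proof.
move=> z0; rewrite -(level_tail_powR (@measurable_quadrant R) mpr prod_tail_fin k0 ab0 abRV
  (tail_ni mUV_prod) prod_cvg z0) fineK// ge0_fin_numE//; exact: prod_tail_fin.
Qed.

Hypothesis nondeg : ~ degenerate_df (fun x : R =>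
  mu [set p | 0 <= p.1 /\ p.1 <= x%:E /\ 1%:E < p.2]).

(** If [c = 0], the power form kills every product tail, so [xy > 0] is null. On [y > 1] the finite
    values of [x] then carry mass only at [x = 0], a degenerate distribution function. *)
Let c_gt0 : (0 < c)%R.
Proof.
rewrite lt_neqAle fine_ge0// andbT; apply/eqP => c0; apply: nondeg.
have T0 : mu (level_tail Q pr 0) = 0.
  apply/negligibleP; first exact: mprod_tail.
  apply: (@negligibleS _ _ _ _ (\bigcup_n level_tail Q pr n.+1%:R^-1)).
    move=> p [Qp /= p0].
    suff [n pn] : exists n, (n.+1%:R^-1 : R)%:E < pr p by exists n.
    move: p0; case: (pr p) => [r| |//]; last by exists 0%N; rewrite ltry.
    rewrite lte_fin => r0; exists (Num.truncn r^-1).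
    by rewrite lte_fin invf_plt ?posrE// truncnS_gt.
  apply: negligible_bigcup => n; apply/negligibleP; first exact: mprod_tail.
  have n0 : (0 < n.+1%:R^-1 :> R)%R by rewrite invr_gt0.
  by have := prod_tailE n0; rewrite -c0 mulr0.
pose E (x : R) := [set p : \bar R * \bar R | 0 <= p.1 /\ p.1 <= x%:E /\ 1%:E < p.2].
have mE x : measurable (E x).
  rewrite (_ : E x = level_tail Q snd 1 `&` ~` [set p | x%:E < p.1]).
    apply: measurableI.
      exact: measurable_level_tail (@measurable_quadrant R) (@measurable_snd _ _ _ _) _.
    apply: measurableC; rewrite -[X in measurable X]setTI.
    by apply: emeasurable_fun_o_infty => //; exact: measurable_fst.
  apply/seteqP; split=> p.
    move=> [p1 [px p2]]; split; last by apply/negP; rewrite -leNgt.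
    by split=> //; split=> //; exact: lt_trans p2.
  by move=> [[[p1 _] p2] /negP]; rewrite -leNgt.
(* The jump sits at [0] and has the mass of the edge [x = 0]. *)
exists 0%R, (mu (E 0%R)) => x x0; rewrite x0.
have -> : [set p : \bar R * \bar R | 0 <= p.1 /\ p.1 <= x%:E /\ 1%:E < p.2] =
    E 0%R `|` (E x `&` level_tail Q pr 0).
  apply/seteqP; split=> p /=.
    move=> [p1 [px p2]]; have p20 : 0 < p.2 by exact: lt_trans p2.
    move: (p1); rewrite le_eqVlt => /predU1P[p10|p10].
      by left; split=> //; rewrite -p10.
    by right; split=> //; split; [split|rewrite /= mule_gt0].
  by move=> [[p1 [px p2]]|[]//]; split=> //; split=> //; rewrite (le_trans px) ?lee_fin.
have mEx : measurable (E x `&` level_tail Q pr 0) by exact: measurableI.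
by rewrite measureU0//; apply: (subset_measure0 mEx (mprod_tail 0) _ T0) => p [].
Qed.

Lemma product_tail_limit :
  regvar (- (kx + ky)^-1) (fun x : R => fine (P [set w | x%:E < U w * V w])) /\
  exists nu : {measure set (\bar R) -> \bar R},
    radon_on (measurable : set (set (\bar R))) (posline R) nu /\
    nu [set x | 0 < x < +oo] != 0 /\
    vague_cvg (measurable : set (set (\bar R))) (posline R)
      (fun t A => t%:E * P [set w | A (U w * V w *
                                       ((alpha t * a t)^-1)%:E)]) nu.
Proof.
split.
  have [Gpos GRV] := regvar_of_tail k0 ab0 abRV (tail_ni mUV_prod) c_gt0 prod_tail_cvg.
  split; last by split.
  by apply: nonincreasing_measurable => // x y xy; exact: (tail_ni mUV_prod xy).
(* Restricting to [xy > 0] before taking the image leaves no mass outside [posline R]. *)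
have [nu nuE] := restricted_pushforward mu (mprod_tail 0) mpr.
have nuA A : A `<=` posline R -> nu A = mu (Q `&` pr @^-1` A).
  move=> A0; rewrite nuE; congr (mu _); apply/seteqP; split=> p [].
    by move=> [].
  by move=> Qp Ap; split=> //; split=> //; exact: A0.
(* The closure of [A] misses [0], hence a ball around it; half the radius serves as [z]. *)
have away A : rel_compact (posline R) A -> exists2 z : R, (0 < z)%R & A `<=` [set x | z%:E < x].
  move=> [_ clA].
  have : nbhs (0 : \bar R) (~` closure A).
    apply: open_nbhs_nbhs; split; first exact/closed_openC/closed_closure.
    by move=> /clA; rewrite /posline /= ltxx.
  rewrite /nbhs /= /ereal_nbhs => /nbhs_ballP[e /= e0 eA].
  exists (e / 2)%R; first exact: divr_gt0.
  move=> x Ax; rewrite /= ltNge; apply/negP => xe.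
  have := clA _ (subset_closure Ax); rewrite /posline /= => x0.
  case: x x0 xe Ax => [r| |]//; rewrite lte_fin lee_fin => r0 re Ar.
  apply: (eA r); last exact: subset_closure.
  rewrite /ball /= sub0r normrN gtr0_norm// (le_lt_trans re)//.
  by rewrite ltr_pdivrMr// ltr_pMr// ltr1n.
exists nu; split; [split|split].
- rewrite nuE (_ : _ `&` _ = set0) ?measure0// -subset0 => p [[_ /= p0] np].
  exact: np.
- move=> A mA /away[z z0 Az]; apply: le_lt_trans (prod_tail_fin z0).
  rewrite nuA; last by move=> x /Az; apply: lt_trans; rewrite lte_fin.
  apply: le_measure; rewrite ?inE//.
    apply: measurableI; first exact: measurable_quadrant.
    by rewrite -[X in measurable X]setTI; exact: mpr.
  by move=> p [Qp /Az].
- rewrite nuA; last by move=> x /andP[].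
  rewrite gt_eqF//; apply: (@lt_le_trans _ _ (mu (level_tail Q pr 1))).
    by rewrite prod_tailE// powR1 mul1r lte_fin.
  (* No mass sits at an infinite product, so the positive tail mass [c] is carried by finite
     values. *)
  have oo0 := level_pinfty_null (@measurable_quadrant R) mpr prod_tail_fin k0 ab0 abRV
    (tail_ni mUV_prod) prod_cvg.
  have mI : measurable [set x : \bar R | 0 < x < +oo].
    rewrite (_ : [set _ | _] = posline R `\` [set +oo]).
      by apply: measurableD => //; exact: emeasurable_set1.
    apply/seteqP; split=> x /=.
      by move=> /andP[x0 xoo]; split=> // xE; rewrite xE ltxx in xoo.
    move=> [x0 xoo]; rewrite (x0 : 0 < x) lt_neqAle leey andbT/=.
    exact/eqP.
  have mQ := measurable_level (@measurable_quadrant R) mpr +oo.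
  have mQI : measurable (Q `&` pr @^-1` [set x : \bar R | 0 < x < +oo]).
    apply: measurableI; first exact: measurable_quadrant.
    by rewrite -[X in measurable X]setTI; exact: mpr.
  rewrite -[leRHS]adde0 -[X in _ + X]oo0; apply: le_trans (measureU2 mu mQI mQ).
  apply: le_measure; rewrite ?inE//; first exact: measurableU.
  move=> p [Qp /= p1]; have [poo|poo] := eqVneq (pr p) +oo; [right|left]; split=> //=.
  by rewrite (lt_trans _ p1)//= lt_neqAle poo leey.
- move=> A mA cA bA0; have [z z0 Az] := away A cA.
  have A0 : A `<=` posline R by move=> x /Az; apply: lt_trans; rewrite lte_fin.
  rewrite nuA//.
  under eq_fun do under eq_set do rewrite -scale_prod.
  apply: (prod_vague z0 mA Az); first by case: cA.
  rewrite -nuA//; by move=> x [[]].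
Qed.

End product_tail.

(** * Return to the variables [X] and [Y] *)

Unset Implicit Arguments.

Theorem theorem5p6 (R : realType) (d : measure_display) (T : measurableType d)
  (P : probability T R) (X Y : {RV P >-> R}) (rho gamma : R)
  (alpha a : R -> R)
  (mu : {measure set (\bar R * \bar R) -> \bar R}) :
  (rho < 0)%R -> (gamma < 0)%R ->
  (forall w, (X w <= 0)%R) -> (forall w, (Y w <= 0)%R) ->
  (forall e : R, (0 < e)%R -> 0 < P [set w | (- e < X w)%R]) ->
  (forall e : R, (0 < e)%R -> 0 < P [set w | (- e < Y w)%R]) ->
  regvar (- rho) alpha -> regvar (- gamma) a ->
  radon_on (measurable : set (set (\bar R * \bar R)%type)) (quadrant R) mu ->
  mu (quadrant R) != 0 ->
  vague_cvg (measurable : set (set (\bar R * \bar R)%type)) (quadrant R)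
    (fun t A => t%:E * P [set w | A (tilde (X w) * ((alpha t)^-1)%:E,
                                    tilde (Y w) * ((a t)^-1)%:E)]) mu ->
  (forall y : R, (0 < y)%R ->
     ~ degenerate_df (fun x : R =>
         mu [set p | 0 <= p.1 /\ p.1 <= x%:E /\ y%:E < p.2])) ->
  (forall z : R, (0 < z)%R ->
     limf_esup (fun eps : R =>
        limf_esup (fun t : R =>
          t%:E * P [set w | (z / eps)%:E < tilde (X w) * ((alpha t)^-1)%:E])
          +oo%R) 0%R^'+ = 0
) ->
  regvar (- (1 / (`|gamma| + `|rho|)))
    (fun x : R => fine (P [set w | x%:E < inv_prod (X w) (Y w)])) /\
  exists nu : {measure set (\bar R) -> \bar R},
    radon_on (measurable : set (set (\bar R))) (posline R) nu /\
    nu [set x | 0 < x < +oo] != 0 /\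
    vague_cvg (measurable : set (set (\bar R))) (posline R)
      (fun t A => t%:E * P [set w | A (inv_prod (X w) (Y w) *
                                       ((alpha t * a t)^-1)%:E)]) nu.
Proof.
move=> rho0 gamma0 X0 Y0 _ _ [_ [alpha0 alphaRV]] [_ [a0 aRV]] [_ mu_fin] _ muV
  nondeg tailX.
have krg : (`|gamma| + `|rho| = - rho + - gamma)%R.
  by rewrite !ltr0_norm// addrC.
(* Both limits superior are unfolded: the outer one, being [0 < eta], gives [delta], and the inner
   one then gives the bound for all large [t]. *)
have tailU (z eta : R) : (0 < z)%R -> (0 < eta)%R ->
    exists2 delta : R, (0 < delta)%R & forall e : R, (0 < e)%R -> (e < delta)%R ->
    \forall t \near +oo%R,
      t%:E * P [set w | (z / e)%:E < tilde (X w) * ((alpha t)^-1)%:E] <= eta%:E.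
  move=> z0 eta0.
  have := tailX z z0; set f := (X in limf_esup X _) => f0.
  have [A A0 fA] : exists2 A, 0%R^'+ A & forall x, A x -> f x < eta%:E.
    by apply: limf_esup_lt; rewrite f0 lte_fin.
  have [delta /= delta0 dA] := A0.
  exists delta => // e e0 ed.
  have /fA/limf_esup_lt[B FB fB] : A e.
    by apply: dA => //=; rewrite sub0r normrN gtr0_norm.
  by apply: filterS FB => t /fB/ltW.
have mX := measurableT_comp (@measurable_tilde R) (measurable_funPT X).
have mY := measurableT_comp (@measurable_tilde R) (measurable_funPT Y).
have rho0' : (0 < - rho)%R by rewrite oppr_gt0.
have gamma0' : (0 < - gamma)%R by rewrite oppr_gt0.
have [rv lim] := product_tail_limit mX mY (fun w => tilde_gt0 (X w))
  (fun w => tilde_gt0 (Y w)) rho0' gamma0' alpha0 a0 alphaRV aRV mu_fin muV tailU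
  (nondeg 1%R ltr01).
rewrite krg div1r.
have XY w : inv_prod (X w) (Y w) = tilde (X w) * tilde (Y w) by exact: inv_prodE.
split.
  by under eq_fun do under eq_set do rewrite XY.
have [nu [nu_radon [nu_neq0 nu_cvg]]] := lim.
exists nu; do 2!split=> //.
by under eq_fun do under eq_fun do under eq_set do rewrite XY.
Qed.
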